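(* Every Picard groupoid is equivalent, as a symmetric monoidal category, to a Picard groupoid which is both skeletal and permutative.
   Context: A Picard groupoid is a symmetric monoidal groupoid $(\mathcal{C},\oplus,I)$ in which every object $x$ is invertible, i.e. there are an object $y$ and an isomorphism $y\oplus x\to I$. A Picard groupoid is permutative if its monoidal structure is strictly associative and strictly unital (the symmetry need not be the identity). A category is skeletal if isomorphic objects are equal. Equivalence as symmetric monoidal categories means there is a strong symmetric monoidal functor that is an equivalence of underlying categories. *)

(* Defs.v *)
(* Only the Prelude is used.  Morphisms are compared with Leibniz equality, and
   [g ∘ f] is "first f, then g". *)

Set Implicit Arguments.
Unset Strict Implicit.

Declare Scope cat_scope.
Delimit Scope cat_scope with cat.
Open Scope cat_scope.

Record Category := {
  Obj :> Type;
  Hom : Obj -> Obj -> Type;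
  idm : forall x, Hom x x;
  comp : forall x y z, Hom y z -> Hom x y -> Hom x z;
  comp_idl : forall x y (f : Hom x y), comp (idm y) f = f;
  comp_idr : forall x y (f : Hom x y), comp f (idm x) = f;
  comp_assoc : forall w x y z (h : Hom y z) (g : Hom x y) (f : Hom w x),
    comp h (comp g f) = comp (comp h g) f
}.
Arguments Hom {c} x y.
Arguments idm {c} x.
Arguments comp {c x y z} g f.

Notation "x ~> y" := (Hom x y) (at level 90, no associativity) : cat_scope.
Notation "g ∘ f" := (comp g f) (at level 40, left associativity) : cat_scope.

Definition is_iso (C : Category) (x y : C) (f : x ~> y) : Prop :=
  exists g : y ~> x, g ∘ f = idm x /\ f ∘ g = idm y.

Definition isomorphic (C : Category) (x y : C) : Prop :=
  exists f : x ~> y, is_iso f.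

Definition groupoid (C : Category) : Prop :=
  forall (x y : C) (f : x ~> y), is_iso f.

Definition skeletal (C : Category) : Prop :=
  forall x y : C, isomorphic x y -> x = y.

(* An arrow [x ~> y] can be an identity only if [x = y]; as an inductive family
   this needs no transport along that equality. *)
Inductive is_identity (C : Category) : forall x y : C, x ~> y -> Prop :=
  is_identity_idm : forall x : C, is_identity (idm x).

Record Functor (C D : Category) := {
  fobj :> C -> D;
  fmap : forall x y : C, x ~> y -> fobj x ~> fobj y;
  fmap_id : forall x : C, fmap (idm x) = idm (fobj x);
  fmap_comp : forall (x y z : C) (g : y ~> z) (f : x ~> y),
    fmap (g ∘ f) = fmap g ∘ fmap f
}.
Arguments fmap {C D} F {x y} f : rename.

Definition functor_id (C : Category) : Functor C C :=
  {| fobj := fun x => x;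
     fmap := fun x y f => f;
     fmap_id := fun x => eq_refl;
     fmap_comp := fun x y z g f => eq_refl |}.

Definition functor_comp (C D E : Category)
    (G : Functor D E) (F : Functor C D) : Functor C E :=
  {| fobj := fun x => G (F x);
     fmap := fun x y f => fmap G (fmap F f);
     fmap_id := fun x =>
       eq_trans (f_equal (fun f => fmap G f) (fmap_id F x)) (fmap_id G (F x));
     fmap_comp := fun x y z g f =>
       eq_trans (f_equal (fun h => fmap G h) (fmap_comp F g f))
                (fmap_comp G (fmap F g) (fmap F f)) |}.

Definition naturally_isomorphic (C D : Category) (F G : Functor C D) : Prop :=
  exists t : forall x : C, F x ~> G x,
    (forall x, is_iso (t x)) /\
    (forall (x y : C) (f : x ~> y), t y ∘ fmap F f = fmap G f ∘ t x).

Definition is_equivalence (C D : Category) (F : Functor C D) : Prop :=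
  exists G : Functor D C,
    naturally_isomorphic (functor_comp G F) (functor_id C) /\
    naturally_isomorphic (functor_comp F G) (functor_id D).

Record SymMonCat := {
  smc_cat :> Category;
  unit_obj : smc_cat;
  tens : smc_cat -> smc_cat -> smc_cat;
  tensm : forall x x' y y' : smc_cat,
    (x ~> x') -> (y ~> y') -> (tens x y ~> tens x' y');
  assoc : forall x y z : smc_cat, tens (tens x y) z ~> tens x (tens y z);
  lunit : forall x : smc_cat, tens unit_obj x ~> x;
  runit : forall x : smc_cat, tens x unit_obj ~> x;
  symm : forall x y : smc_cat, tens x y ~> tens y x;

  tensm_id : forall x y : smc_cat, tensm (idm x) (idm y) = idm (tens x y);
  tensm_comp : forall (x x' x'' y y' y'' : smc_cat)
      (f' : x' ~> x'') (f : x ~> x') (g' : y' ~> y'') (g : y ~> y'),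
    tensm (f' ∘ f) (g' ∘ g) = tensm f' g' ∘ tensm f g;

  assoc_iso : forall x y z, is_iso (assoc x y z);
  assoc_nat : forall (x x' y y' z z' : smc_cat)
      (f : x ~> x') (g : y ~> y') (h : z ~> z'),
    assoc x' y' z' ∘ tensm (tensm f g) h = tensm f (tensm g h) ∘ assoc x y z;
  lunit_iso : forall x, is_iso (lunit x);
  lunit_nat : forall (x x' : smc_cat) (f : x ~> x'),
    lunit x' ∘ tensm (idm unit_obj) f = f ∘ lunit x;
  runit_iso : forall x, is_iso (runit x);
  runit_nat : forall (x x' : smc_cat) (f : x ~> x'),
    runit x' ∘ tensm f (idm unit_obj) = f ∘ runit x;
  symm_nat : forall (x x' y y' : smc_cat) (f : x ~> x') (g : y ~> y'),
    symm x' y' ∘ tensm f g = tensm g f ∘ symm x y;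

  pentagon : forall w x y z : smc_cat,
    assoc w x (tens y z) ∘ assoc (tens w x) y z
    = tensm (idm w) (assoc x y z)
      ∘ assoc w (tens x y) z
      ∘ tensm (assoc w x y) (idm z);
  triangle : forall x y : smc_cat,
    tensm (idm x) (lunit y) ∘ assoc x unit_obj y = tensm (runit x) (idm y);
  symm_invol : forall x y : smc_cat, symm y x ∘ symm x y = idm (tens x y);
  hexagon : forall x y z : smc_cat,
    assoc y z x ∘ symm x (tens y z) ∘ assoc x y z
    = tensm (idm y) (symm x z) ∘ assoc y x z ∘ tensm (symm x y) (idm z)
}.
Arguments unit_obj {s}.
Arguments tens {s} x y.
Arguments tensm {s x x' y y'} f g.
Arguments assoc {s} x y z.
Arguments lunit {s} x.
Arguments runit {s} x.
Arguments symm {s} x y.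

Notation "x ⊕ y" := (tens x y) (at level 35, right associativity) : cat_scope.
Notation "f ⊕m g" := (tensm f g) (at level 35, right associativity) : cat_scope.

Definition invertible (C : SymMonCat) (x : C) : Prop :=
  exists y : C, isomorphic (y ⊕ x) unit_obj.

Definition picard (C : SymMonCat) : Prop :=
  groupoid C /\ forall x : C, invertible x.

(* [symm] is unconstrained. *)
Definition permutative (C : SymMonCat) : Prop :=
  (forall x y z : C, is_identity (assoc x y z)) /\
  (forall x : C, is_identity (lunit x)) /\
  (forall x : C, is_identity (runit x)).

Record StrongSymMonFunctor (C D : SymMonCat) := {
  smf_functor :> Functor C D;
  smf_mu : forall x y : C,
    smf_functor x ⊕ smf_functor y ~> smf_functor (x ⊕ y);
  smf_eps : unit_obj ~> smf_functor unit_obj;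

  smf_mu_iso : forall x y, is_iso (smf_mu x y);
  smf_eps_iso : is_iso smf_eps;
  smf_mu_nat : forall (x x' y y' : C) (f : x ~> x') (g : y ~> y'),
    smf_mu x' y' ∘ (fmap smf_functor f ⊕m fmap smf_functor g)
    = fmap smf_functor (f ⊕m g) ∘ smf_mu x y;

  smf_assoc : forall x y z : C,
    smf_mu x (y ⊕ z)
      ∘ (idm (smf_functor x) ⊕m smf_mu y z)
      ∘ assoc (smf_functor x) (smf_functor y) (smf_functor z)
    = fmap smf_functor (assoc x y z)
      ∘ smf_mu (x ⊕ y) z
      ∘ (smf_mu x y ⊕m idm (smf_functor z));
  smf_lunit : forall x : C,
    fmap smf_functor (lunit x)
      ∘ smf_mu unit_obj x
      ∘ (smf_eps ⊕m idm (smf_functor x))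
    = lunit (smf_functor x);
  smf_runit : forall x : C,
    fmap smf_functor (runit x)
      ∘ smf_mu x unit_obj
      ∘ (idm (smf_functor x) ⊕m smf_eps)
    = runit (smf_functor x);
  smf_symm : forall x y : C,
    fmap smf_functor (symm x y) ∘ smf_mu x y
    = smf_mu y x ∘ symm (smf_functor x) (smf_functor y)
}.

Definition sym_mon_equivalent (C D : SymMonCat) : Prop :=
  exists F : StrongSymMonFunctor C D, is_equivalence F.

(* Main.v *)
(** By invertibility, every automorphism group of a Picard groupoid is
    canonically the abelian group [pi1] of endomorphisms of the unit, so that the
    isomorphism classes [pi0], the associator and the symmetry give a symmetric
    3-cocycle [(h, c)] on [pi0] with values in [pi1].  A skeletal permutative
    model exists as soon as [h] is a coboundary.  This is proved by Zorn's lemma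
    over trivializations of [h] on subgroups [S] of [pi0] for which the bilinear
    form left over from [c] vanishes on [(S ∩ 2 pi0) × S].  To adjoin [x] to [S],
    one extends the trivialization to [S × Z] and descends along the quotient map
    to [S + Z x], whose kernel is cyclic; the obstruction is the form on this
    kernel.  It vanishes because [c(x, x)] is killed by 2, and because one may
    assume that either [x ∈ 2 pi0] (and then [c(x, x) = 0]) or [x ∉ S + 2 pi0], in
    which case [m x ∈ S] forces [m] to be even. *)

From HB Require Import structures.
From mathcomp Require Import all_boot all_algebra boolp classical_sets.
Require Import Defs.

Set Implicit Arguments.
Unset Strict Implicit.
Unset Printing Implicit Defensive.
Import GRing.Theory.
Local Open Scope classical_set_scope.
Local Open Scope ring_scope.

(** * A decision procedure for equations in abelian groups *)

Inductive zmexpr :=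
  | ZMvar of nat | ZM0 | ZMadd of zmexpr & zmexpr | ZMopp of zmexpr.

Section ZmodReflection.
Variable V : zmodType.

Fixpoint zm_eval (env : seq V) e : V :=
  match e with
  | ZMvar i => env`_i
  | ZM0 => 0
  | ZMadd e1 e2 => zm_eval env e1 + zm_eval env e2
  | ZMopp e1 => - zm_eval env e1
  end.

Fixpoint zm_coef i e : int :=
  match e with
  | ZMvar j => if j == i then 1 else 0
  | ZM0 => 0
  | ZMadd e1 e2 => zm_coef i e1 + zm_coef i e2
  | ZMopp e1 => - zm_coef i e1
  end.

Lemma zm_evalE env e :
  zm_eval env e = \sum_(i < size env) env`_i *~ zm_coef i e.
Proof.
elim: e => [j||e1 IH1 e2 IH2|e IH] /=.
- have [lt_j|ge_j] := ltnP j (size env).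
    rewrite (bigD1 (Ordinal lt_j)) //= eqxx big1 ?addr0 // => i ne_i.
    by rewrite eq_sym -val_eqE /= in ne_i; rewrite (negPf ne_i).
  rewrite nth_default // big1 // => i _.
  by rewrite gtn_eqF ?(leq_trans (ltn_ord i)).
- by rewrite big1 // => i _; rewrite mulr0z.
- by rewrite IH1 IH2 -big_split /=; apply: eq_bigr => i _; rewrite mulrzDr.
- by rewrite IH -sumrN; apply: eq_bigr => i _; rewrite mulrNz.
Qed.

(** Both sides are integer combinations of the atoms, so it suffices to compare coefficients, which
    is a closed computation. *)
Lemma zm_decide env e1 e2 :
  all (fun i => zm_coef i e1 == zm_coef i e2) (iota 0 (size env)) ->
  zm_eval env e1 = zm_eval env e2.
Proof.
move=> /allP eq_coef; rewrite !zm_evalE; apply: eq_bigr => i _.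
by rewrite (eqP (eq_coef i _)) // mem_iota add0n /= ltn_ord.
Qed.

(** Derives an equation from a combination [l' = r'] of known ones; what remains is an identity for
    [zmod]. *)
Lemma zm_lincomb (l r l' r' : V) : l' = r' -> l - r = l' - r' -> l = r.
Proof. by move=> -> /eqP; rewrite subrr subr_eq0 => /eqP. Qed.

End ZmodReflection.

(* Syntactic equality, except that occurrences of an operation may refer to
   convertible but distinct paths through the hierarchy of structures. *)
Ltac zm_same x y :=
  first [ constr_eq x y
  | lazymatch x with
    | (?a + ?b)%R =>
        lazymatch y with (?a' + ?b')%R => zm_same a a'; zm_same b b' end
    | (- ?a)%R => lazymatch y with (- ?a')%R => zm_same a a' end
    | 0%R => lazymatch y with 0%R => idtac end
    | (?a, ?b) => lazymatch y with (?a', ?b') => zm_same a a'; zm_same b b' end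
    | ?f ?a =>
        lazymatch y with
        | ?f' ?a' => zm_same f f'; first [ zm_same a a' | zm_same_type a a' ]
        end
    end ]
with zm_same_type x y :=
  let T := type of x in
  lazymatch T with
  | Type => unify x y
  | Set => unify x y
  end.
Ltac zm_index x env :=
  lazymatch env with
  | ?y :: ?env' =>
      match constr:(tt) with
      | _ => let _ := match constr:(tt) with _ => zm_same x y end in
             constr:(0%N)
      | _ => let i := zm_index x env' in constr:(S i)
      end
  end.
Ltac zm_insert x env :=
  match constr:(tt) with
  | _ => let _ := zm_index x env in env
  | _ => constr:(x :: env)
  end.
Ltac zm_atoms t env :=
  lazymatch t with
  | (?a + ?b)%R => let env' := zm_atoms a env in zm_atoms b env'
  | (- ?a)%R => zm_atoms a env
  | 0%R => env
  | _ => zm_insert t env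
  end.
Ltac zm_reify t env :=
  lazymatch t with
  | (?a + ?b)%R =>
      let a' := zm_reify a env in let b' := zm_reify b env in
      constr:(ZMadd a' b')
  | (- ?a)%R => let a' := zm_reify a env in constr:(ZMopp a')
  | 0%R => constr:(ZM0)
  | _ => let i := zm_index t env in constr:(ZMvar i)
  end.
Ltac zmod :=
  lazymatch goal with
  | |- @eq ?V ?l ?r =>
      let env := zm_atoms l (@nil V) in
      let env := zm_atoms r env in
      let l' := zm_reify l env in
      let r' := zm_reify r env in
      apply: (@zm_decide _ env l' r'); vm_compute; reflexivity
  end.

(** * Symmetric 3-cocycles *)

Section Cocycles.
Variables A B : zmodType.
Implicit Types (h : A -> A -> A -> B) (c k : A -> A -> B).

(* [k] changes the chosen isomorphisms [x ⊕ y ~> x + y]; [twist h k] and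
   [alt c k] are the resulting associator and symmetry. *)
Definition cob k (x y z : A) : B := k y z - k (x + y) z + k x (y + z) - k x y.

Definition alt c k (x y : A) : B := c x y - k x y + k y x.

(** The pentagon, the hexagon and the involutivity of the symmetry read additively: an Eilenberg-Mac
    Lane abelian 3-cocycle whose braiding is a symmetry. *)
Record sym_cocycle h c : Prop := SymCocycle {
  sym_pentagon : forall w x y z,
    h w x (y + z) + h (w + x) y z = h x y z + h w (x + y) z + h w x y;
  sym_hexagon : forall x y z,
    h y z x + c x (y + z) + h x y z = c x z + h y x z + c x y;
  sym_invol : forall x y, c y x + c x y = 0
}.

Definition twist h k (x y z : A) : B := h x y z + cob k x y z.

Lemma twist_cocycle h c k :
  sym_cocycle h c -> sym_cocycle (twist h k) (alt c k).
Proof.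
case=> pent hex inv; split=> [w x y z|x y z|x y]; rewrite /twist /cob /alt.
- apply: (zm_lincomb (pent w x y z)); rewrite !addrA; zmod.
- apply: (zm_lincomb (hex x y z)).
  rewrite (addrC z x) (addrC y x); zmod.
- apply: (zm_lincomb (inv x y)); zmod.
Qed.

Lemma alt_diag c k x : alt c k x x = c x x.
Proof. by rewrite /alt subrK. Qed.

Lemma twist_twist h k k' :
  twist (twist h k) k' = twist h (fun x y => k x y + k' x y).
Proof.
apply/funext => x; apply/funext => y; apply/funext => z.
by rewrite /twist /cob; zmod.
Qed.

Lemma alt_alt c k k' : alt (alt c k) k' = alt c (fun x y => k x y + k' x y).
Proof. by apply/funext => x; apply/funext => y; rewrite /alt; zmod. Qed.

(** Zero is placed in the middle argument; for a cocycle the pentagon extends the vanishing to the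
    outer ones. *)
Definition normalized h := forall x y, h x 0 y = 0.

Lemma trivializer_r0 h k : normalized h -> k 0 0 = 0 ->
  (forall x y z, twist h k x y z = 0) -> forall x, k x 0 = 0.
Proof.
move=> h0 k00 hk x; have := hk x 0 0; rewrite /twist /cob h0 !addr0 k00 => e.
by apply: (zm_lincomb (esym e)); zmod.
Qed.

Lemma trivializer_l0 h k : normalized h -> k 0 0 = 0 ->
  (forall x y z, twist h k x y z = 0) -> forall x, k 0 x = 0.
Proof.
move=> h0 k00 hk x; have := hk 0 0 x; rewrite /twist /cob h0 !add0r k00 => e.
by apply: (zm_lincomb e); zmod.
Qed.

Section Normalized.
Variables (h : A -> A -> A -> B) (c : A -> A -> B).
Hypotheses (hc : sym_cocycle h c) (h0 : normalized h).

Lemma normalized_l y z : h 0 y z = 0.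
Proof.
have := sym_pentagon hc 0 0 y z; rewrite !add0r !h0 => e.
by apply: (zm_lincomb (esym e)); zmod.
Qed.

Lemma normalized_r x y : h x y 0 = 0.
Proof.
have := sym_pentagon hc x y 0 0; rewrite !addr0 !h0 => e.
by apply: (zm_lincomb (esym e)); zmod.
Qed.

Lemma sym_r0 x : c x 0 = 0.
Proof.
have := sym_hexagon hc x 0 0; rewrite !addr0 !h0 normalized_l => e.
by apply: (zm_lincomb (esym e)); zmod.
Qed.

Lemma sym_l0 x : c 0 x = 0.
Proof. by apply: (zm_lincomb (sym_invol hc x 0)); rewrite sym_r0; zmod. Qed.

Lemma normalized_twist k :
  (forall x, k x 0 = 0) -> (forall x, k 0 x = 0) -> normalized (twist h k).
Proof.
by move=> k0 k1 x y; rewrite /twist /cob h0 !(addr0, add0r) k0 k1; zmod.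
Qed.

End Normalized.

(** The pentagon at [(x, 0, 0, y)] gives [h x 0 y = h 0 0 y + h x 0 0], and at 0 it gives
    [h 0 0 0 = 0]; the cochain [h x 0 0 - h 0 0 y] cancels exactly this. *)
Lemma exists_normalized h c :
  sym_cocycle h c -> exists k, normalized (twist h k).
Proof.
move=> hc; exists (fun x y => h x 0 0 - h 0 0 y) => x y.
have p000 := sym_pentagon hc 0 0 0 0.
have px0y := sym_pentagon hc x 0 0 y.
rewrite /twist /cob; rewrite !(addr0, add0r) in p000 px0y *.
apply: (zm_lincomb (congr2 +%R px0y (esym (congr2 +%R p000 p000)))); zmod.
Qed.

(** The hexagon at [(2y, y, y)] and the pentagon at [(y, y, y, y)] give
    [c(2y, 2y) = 2 c(2y, y) - 2 h(y, y, y)]. By involutivity and the hexagon at [(y, y, y)] this is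
    [- 4 c(y, y)], and [2 c(y, y) = 0]. *)
Lemma sym_double h c y : sym_cocycle h c -> c (y + y) (y + y) = 0.
Proof.
case=> pent hex inv.
have e1 := hex (y + y) y y.
have e2 := hex y y y.
have e3 := inv (y + y) y.
have e4 := pent y y y y.
have e5 := inv y y.
apply: (zm_lincomb (congr2 +%R e1 (congr2 +%R (congr2 +%R e3 e3)
  (esym (congr2 +%R e4 (congr2 +%R (congr2 +%R e2 e2) (congr2 +%R e5 e5))))))).
by zmod.
Qed.

Section Trivialized.
Variables (h : A -> A -> A -> B) (c : A -> A -> B).
Hypotheses (hc : sym_cocycle h c) (h0 : forall x y z, h x y z = 0).

Lemma sym_bilin_r x y z : c x (y + z) = c x y + c x z.
Proof.
have := sym_hexagon hc x y z; rewrite !h0 => e.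
by apply: (zm_lincomb e); zmod.
Qed.

Lemma sym_bilin_l x y z : c (x + y) z = c x z + c y z.
Proof.
have [[i1 i2] i3] := (sym_invol hc (x + y) z, sym_invol hc x z, sym_invol hc y z).
apply: (zm_lincomb (congr2 +%R i1 (esym (congr2 +%R i2 i3)))).
by rewrite sym_bilin_r; zmod.
Qed.

Lemma sym_bilinz_r x y m : c x (y *~ m) = c x y *~ m.
Proof.
pose f := c x.
have fB : zmod_morphism f.
  move=> u v; apply: (addIr (f v)).
  by rewrite subrK /f -sym_bilin_r subrK.
pose F : {additive A -> B} :=
  HB.pack f (GRing.isZmodMorphism.Build A B f fB).
exact: (raddfMz F).
Qed.

Lemma sym_bilinz_l x y m : c (x *~ m) y = c x y *~ m.
Proof.
have e1 := sym_invol hc (x *~ m) y.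
have e2 : c y x *~ m + c x y *~ m = 0.
  by rewrite -mulrzDl (sym_invol hc) mul0rz.
rewrite sym_bilinz_r in e1.
by apply: (zm_lincomb (congr2 +%R e1 (esym e2))); zmod.
Qed.

End Trivialized.
End Cocycles.

Lemma sym_cocycle_pullback (A A' B : zmodType) (f : {additive A' -> A})
    (h : A -> A -> A -> B) (c : A -> A -> B) : sym_cocycle h c ->
  sym_cocycle (fun x y z => h (f x) (f y) (f z)) (fun x y => c (f x) (f y)).
Proof.
by case=> pent hex inv; split=> *; rewrite ?raddfD ?pent ?hex ?inv.
Qed.

(** * Sums and step-invariant functions on the integers *)

Section IntSum.
Variable B : zmodType.

(** The discrete antiderivative of [F] vanishing at 0; the signed sum for negative [m] makes [zsumS]
    hold at every integer. *)
Definition zsum (F : int -> B) (m : int) : B :=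
  match m with
  | Posz n => \sum_(i < n) F i
  | Negz n => - \sum_(i < n.+1) F (- (i%:Z + 1))
  end.

Lemma zsum0 F : zsum F 0 = 0.
Proof. exact: big_ord0. Qed.

Lemma zsumS F m : zsum F (m + 1) = zsum F m + F m.
Proof.
case: m => [n|[|n]]; first by rewrite addrC -intS /= big_ord_recr.
  rewrite /= big_ord_recr !big_ord0 /= add0r addrC.
  by rewrite -[RHS]/(F (-1) - F (-1)) subrr.
have -> : Negz n.+1 + 1 = Negz n by rewrite !NegzE intS; zmod.
rewrite [in RHS]/= big_ord_recr /= NegzE.
have -> : (n.+2%:Z = n.+1%:Z + 1) by rewrite intS addrC.
by rewrite opprD subrK.
Qed.

Lemma int_step_eq (P : int -> B) m : (forall n, P (n + 1) = P n) -> P m = P 0.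
Proof.
move=> PS; case: m => n.
  by elim: n => // n IH; rewrite intS addrC PS.
elim: n => [|n IH]; first by rewrite -(PS (Negz 0)).
by rewrite -IH -(PS (Negz n.+1)); congr P; rewrite !NegzE intS; zmod.
Qed.

End IntSum.

(** * Extension to [A × Z] *)

(* A named constant, so that unification does not compute with pairs. *)
Definition prodZ (A : zmodType) : zmodType := (A * int)%type.

Section ExtendByInt.
Variables A B : zmodType.
Local Notation G := (prodZ A).

Definition inA (a : A) : G := (a, 0).
Definition inZ (m : int) : G := (0, m).

Lemma inA_D a b : inA a + inA b = inA (a + b).
Proof. by rewrite /inA -[LHS]/(a + b, 0 + 0) addr0. Qed.
Lemma inZ_D m n : inZ m + inZ n = inZ (m + n).
Proof. by rewrite /inZ -[LHS]/(0 + 0, m + n) addr0. Qed.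
Lemma inAZ a m : inA a + inZ m = (a, m).
Proof. by rewrite -[LHS]/(a + 0, 0 + m) addr0 add0r. Qed.

Lemma inA0 : inA 0 = 0. Proof. by []. Qed.
Lemma inZ0 : inZ 0 = 0. Proof. by []. Qed.

(** The pentagon ending in [inZ 1] makes [h] independent of the integer component of its last
    argument. The hexagon then settles the remaining triples of pure arguments, as [c] vanishes on
    mixed pairs, and further pentagons split the mixed arguments. *)
Lemma sym_cocycle_vanish (h : G -> G -> G -> B) (c : G -> G -> B) :
  sym_cocycle h c -> normalized h ->
  (forall u v, h u v (inZ 1) = 0) ->
  (forall a m b, h (inA a) (inZ m) (inA b) = 0) ->
  (forall a b d, h (inA a) (inA b) (inA d) = 0) ->
  (forall m a, c (inZ m) (inA a) = 0) ->
  forall u v w, h u v w = 0.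
Proof.
move=> hc h0 hx hAZA hAAA cZA.
have pent := sym_pentagon hc.
have hex := sym_hexagon hc.
have h_step u v w : h u v (w + inZ 1) = h u v w.
  have p := pent u v w (inZ 1); rewrite !hx in p.
  by apply: (zm_lincomb p); zmod.
have hA u v a m : h u v (inA a + inZ m) = h u v (inA a).
  have := @int_step_eq B (fun n => h u v (inA a + inZ n)) m.
  rewrite inZ0 addr0; apply=> n.
  by rewrite -inZ_D addrA h_step.
have hZ u v m : h u v (inZ m) = 0.
  have := hA u v 0 m; rewrite inA0 add0r => ->.
  exact: normalized_r hc h0 _ _.
have cAZ m a : c (inA a) (inZ m) = 0.
  by apply: (zm_lincomb (sym_invol hc (inZ m) (inA a))); rewrite cZA; zmod.
have hZAA m a b : h (inZ m) (inA a) (inA b) = 0.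
  have e := hex (inZ m) (inA a) (inA b).
  rewrite inA_D !cZA hAZA hZ in e.
  by apply: (zm_lincomb e); zmod.
have hZZA m n a : h (inZ m) (inZ n) (inA a) = 0.
  have e := hex (inA a) (inZ m) (inZ n).
  rewrite inZ_D !cAZ !hZ in e.
  by apply: (zm_lincomb e); zmod.
have hAGA a v b : h (inA a) v (inA b) = 0.
  case: v => d m; rewrite -inAZ.
  have p := pent (inA a) (inA d) (inZ m) (inA b).
  rewrite (addrC (inZ m)) hA inA_D !hAZA !hAAA hZ in p.
  by apply: (zm_lincomb (esym p)); zmod.
have hGZA u m b : h u (inZ m) (inA b) = 0.
  case: u => a n; rewrite -inAZ.
  have p := pent (inA a) (inZ n) (inZ m) (inA b).
  rewrite (addrC (inZ m)) hA inZ_D hAZA hZZA hAGA hZ in p.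
  by apply: (zm_lincomb p); zmod.
have hZGA m v b : h (inZ m) v (inA b) = 0.
  case: v => a n; rewrite -inAZ.
  have p := pent (inZ m) (inA a) (inZ n) (inA b).
  rewrite (addrC (inZ n)) hA !hZAA hAZA hGZA hZ in p.
  by apply: (zm_lincomb (esym p)); zmod.
move=> [a m] v [b n]; rewrite -!inAZ hA.
have p := pent (inA a) (inZ m) v (inA b).
have e : h (inA a) (inZ m) (v + inA b) = 0.
  by case: v {p} => d l; rewrite -inAZ addrAC inA_D hA hAZA.
have e' : h (inA a) (inZ m) v = 0 by case: (v) => d l; rewrite -inAZ hA.
rewrite e e' hZGA hAGA in p.
by apply: (zm_lincomb p); zmod.
Qed.

Section Construction.
Variables (h : G -> G -> G -> B) (c : G -> G -> B) (k0 : A -> A -> B).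
Hypotheses (hc : sym_cocycle h c) (h0 : normalized h).
Hypotheses (k00 : k0 0 0 = 0)
  (hk0 : forall a b d, h (inA a) (inA b) (inA d) + cob k0 a b d = 0).

(* First impose [k u (inZ 1) = 0] and [twist h k u v (inZ 1) = 0], which
   determines [k] from its values on [A] in the second argument; these are then
   forced by the symmetry and the restriction to [A]. *)
Lemma extend_by_int : exists k : G -> G -> B,
  [/\ forall u v w, twist h k u v w = 0,
      forall a b, k (inA a) (inA b) = k0 a b
    & forall m a, alt c k (inZ m) (inA a) = 0].
Proof.
pose h' (a b d : A) := h (inA a) (inA b) (inA d).
have h'0 : normalized h' by move=> a b; exact: h0.
have k0r := trivializer_r0 h'0 k00 hk0.
have k0l := trivializer_l0 h'0 k00 hk0.
pose x := inZ 1.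
(* Solves the recursion [k1 u (v + x) = k1 u v - h u v x], which makes [twist h k1 u v x] vanish. *)
pose k1 (u v : G) := - zsum (fun i => h u (v.1, i) x) v.2.
have k1S u v : k1 u (v + x) = k1 u v - h u v x.
  by case: v => a m; rewrite /k1 /= -opprD zsumS addr0.
have k1A u a : k1 u (inA a) = 0 by rewrite /k1 zsum0 oppr0.
have k1x u : k1 u x = 0.
  by rewrite -(add0r x) k1S h0 subr0; exact: k1A.
have k1l u : k1 0 u = 0.
  rewrite /k1; case: u => a m /=.
  rewrite (@int_step_eq _ (zsum _) m) ?zsum0 ?oppr0 // => n.
  by rewrite zsumS (normalized_l hc h0) addr0.
pose h1 := twist h k1; pose c1 := alt c k1.
have hc1 : sym_cocycle h1 c1 by exact: twist_cocycle.
have h10 : normalized h1.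
  by apply: normalized_twist => // u; exact: (k1A u 0).
have h1x u v : h1 u v x = 0 by rewrite /h1 /twist /cob k1S !k1x; zmod.
have h1A a b d : h1 (inA a) (inA b) (inA d) = - cob k0 a b d.
  rewrite /h1 /twist /cob inA_D !k1A.
  by apply: (zm_lincomb (hk0 a b d)); rewrite /cob; zmod.
(* With [k2] independent of [v.2], the symmetry forces [k2 (inZ m) (inA b) = c1 (inZ m) (inA b)]; on
   [A] it must be [k0], and the twist at [(inA a, inZ m, inA b)] determines the general value from
   these. *)
pose k2 (u v : G) :=
  h1 (inA u.1) (inZ u.2) (inA v.1) + c1 (inZ u.2) (inA v.1) + k0 u.1 v.1.
have k2A a b : k2 (inA a) (inA b) = k0 a b.
  by rewrite /k2 /= h10 (sym_l0 hc1 h10) !add0r.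
have k2Z u m : k2 u (inZ m) = 0.
  by rewrite /k2 /= (normalized_r hc1 h10) (sym_r0 hc1 h10) k0r !add0r.
have k20 u : k2 u 0 = 0 by exact: (k2Z u 0).
have k2l v : k2 0 v = 0.
  by rewrite /k2 /= h10 (sym_l0 hc1 h10) k0l !add0r.
pose h2 := twist h1 k2; pose c2 := alt c1 k2.
have hc2 : sym_cocycle h2 c2 by exact: twist_cocycle.
have h20 : normalized h2 by exact: normalized_twist.
have k2D u a m : k2 u (inA a + inZ m) = k2 u (inA a).
  by rewrite inAZ.
have c2Z m a : c2 (inZ m) (inA a) = 0.
  rewrite /c2 /alt k2Z /k2 /= (normalized_l hc1 h10) k0l; zmod.
exists (fun u v => k1 u v + k2 u v); split.
- rewrite -twist_twist; apply: (sym_cocycle_vanish hc2 h20) => //.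
  + move=> u v; rewrite /h2 /twist /cob h1x !k2Z.
    case: v => a m; rewrite -inAZ -(addrA (inA a)) inZ_D !k2D; zmod.
  + move=> a m b; rewrite /h2 /twist /cob k2Z (addrC (inZ m)) k2D k2A inAZ.
    by rewrite /k2 /= (normalized_l hc1 h10) k0l; zmod.
  + move=> a b d; rewrite /h2 /twist h1A /cob !inA_D !k2A; zmod.
- by move=> a b; rewrite k1A k2A add0r.
- by move=> m a; rewrite -alt_alt.
Qed.

End Construction.
End ExtendByInt.
Arguments inZ {A} m.

(** * Descent along a cyclic kernel *)

Section Descent.
Variables (A A0 B : zmodType) (p : {additive prodZ A0 -> A}).
Local Notation G := (prodZ A0).
Variables (h : A -> A -> A -> B) (c : A -> A -> B) (k : G -> G -> B) (u0 : G).
Let hp u v w := h (p u) (p v) (p w).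
Let cp u v := c (p u) (p v).
Hypotheses (hc : sym_cocycle h c) (h0 : normalized h).
Hypotheses (k00 : k 0 0 = 0) (hk : forall u v w, twist hp k u v w = 0).
Hypotheses (pu0 : p u0 = 0) (u0_dich : u0 = 0 \/ u0.2 != 0)
  (ker_p : forall u, p u = 0 -> exists q, u = u0 *~ q)
  (rad_p : forall u v, p u = 0 -> alt cp k u v = 0).

(* Correcting [k] by the coboundary of a suitable [j], one gets [k u0 v = 0] for
   all [v]; then [k] vanishes on the kernel and is invariant under it. *)
Lemma descend_trivializer : exists k' : A -> A -> B,
  [/\ forall u v w, twist h k' (p u) (p v) (p w) = 0,
      forall u v, alt c k' (p u) (p v) = alt cp k u v
    & forall a b, k' (p (inA a)) (p (inA b)) = k (inA a) (inA b)].
Proof.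
have hp0 : normalized hp by move=> u v; rewrite /hp raddf0 h0.
have kr := trivializer_r0 hp0 k00 hk.
have kl := trivializer_l0 hp0 k00 hk.
(* If [u0.2] is nonzero, [u - u0 *~ q u] is the reduced representative of the orbit of [u] under
   [u0]; [j] sums [k u0] along the orbit from there, so that [j (u0 + u) = j u + k u0 u]. *)
pose q (u : G) := (u.2 %/ u0.2)%Z.
pose j u := zsum (fun i => k u0 (u - u0 *~ q u + u0 *~ i)) (q u).
have jA a : j (inA a) = 0 by rewrite /j /q div0z zsum0.
have jS u : j (u0 + u) = j u + k u0 u.
  case: u0_dich => [u00|u0_neq0].
    by rewrite u00 add0r kl addr0.
  have qS : q (u0 + u) = q u + 1.
    by have := divzMDl 1 u.2 u0_neq0; rewrite mul1r (addrC 1).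
  have shiftE : u0 + u - u0 *~ (q u + 1) = u - u0 *~ q u.
    by rewrite mulrzDr (_ : u0 *~ 1 = u0) //; zmod.
  by rewrite /j qS zsumS /= shiftE subrK.
pose k1 u v := k u v + j v - j (u + v) + j u.
have k1u0 v : k1 u0 v = 0.
  have ju0 : j u0 = 0 by rewrite -[u0]addr0 jS kr (jA 0) addr0.
  by rewrite /k1 jS ju0; zmod.
have hk1 u v w : hp u v w + cob k1 u v w = 0.
  by apply: (zm_lincomb (hk u v w)); rewrite /twist /cob /k1 (addrA u); zmod.
have alt_k1 u v : alt cp k1 u v = alt cp k u v.
  by rewrite /alt /k1 (addrC v u); zmod.
have hl v w : h 0 v w = 0 by exact: (normalized_l hc).
have hr v w : h v w 0 = 0 by exact: (normalized_r hc).
(* The kernel consists of multiples of [u0], and triviality at [(u0, u0 *~ n, v)] passes from one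
   multiple to the next. *)
have k1l u v : p u = 0 -> k1 u v = 0.
  case/ker_p => m ->; rewrite (@int_step_eq _ (fun m => k1 (u0 *~ m) v)).
    by rewrite /k1 kl !add0r (jA 0) addr0; zmod.
  move=> n; have e := hk1 u0 (u0 *~ n) v.
  have -> : u0 *~ (n + 1) = u0 + u0 *~ n by rewrite mulrzDr addrC.
  rewrite /hp pu0 hl /cob !k1u0 in e.
  by apply: (zm_lincomb (esym e)); zmod.
(* The kernel is in the radical of the form, which exchanges the arguments of [k1]. *)
have k1r u v : p u = 0 -> k1 v u = 0.
  move=> pu; have e := rad_p v pu; rewrite -alt_k1 /alt /cp pu in e.
  rewrite (sym_l0 hc h0) k1l // in e.
  by apply: (zm_lincomb e); zmod.
have k1_congl u v w : p u = 0 -> k1 (u + v) w = k1 v w.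
  move=> pu; have e := hk1 u v w; rewrite /hp /cob pu hl !(k1l u) // in e.
  by apply: (zm_lincomb (esym e)); zmod.
have k1_congr u v w : p u = 0 -> k1 v (w + u) = k1 v w.
  move=> pu; have e := hk1 v w u; rewrite /hp /cob pu hr !(k1r u) // in e.
  by apply: (zm_lincomb e); zmod.
(* [p] may fail to be surjective: [r] is a section over its image, with default value 0
   elsewhere. *)
have [r rP] : exists r : A -> G, forall u, p (r (p u)) = p u.
  have /choice[r rP] : forall a, exists v, (exists u, p u = a) -> p v = a.
    move=> a; have [[u pu]|no] := pselect (exists u, p u = a); last by exists 0.
    by exists u.
  by exists r => u; apply: rP; exists u.
pose k2 a b := k1 (r a) (r b).
have k2E u v : k2 (p u) (p v) = k1 u v.
  have pr w : p (r (p w) - w) = 0 by rewrite raddfB rP subrr.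
  rewrite /k2 -[r (p u)](subrK u) k1_congl //.
  by rewrite -[r (p v)](subrK v) addrC k1_congr.
exists k2; split=> [u v w|u v|a b].
- by rewrite /twist /cob -!raddfD !k2E; exact: hk1.
- by rewrite -alt_k1 /alt !k2E.
- by rewrite k2E /k1 inA_D !jA !addr0 subr0.
Qed.

End Descent.

(** * Symmetric 3-cocycles are coboundaries *)

Section Subgroup.
Variables (A : zmodType) (S : zmodClosed A).
Definition subgroup := {a : A | a \in S}.
HB.instance Definition _ := Choice.on subgroup.
HB.instance Definition _ := [isSub of subgroup for sval].
HB.instance Definition _ := [SubChoice_isSubZmodule of subgroup by <:].
Variable x : A.

Definition adjoin (u : prodZ subgroup) : A := val u.1 + x *~ u.2.

Lemma adjoin_additive : zmod_morphism adjoin.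
Proof.
move=> u v; rewrite /adjoin -[(u - v).1]/(u.1 - v.1) -[(u - v).2]/(u.2 - v.2).
rewrite [val (_ - _)]raddfB mulrzBr /=; zmod.
Qed.

HB.instance Definition _ := GRing.isZmodMorphism.Build _ _ adjoin adjoin_additive.

Lemma prodZ_mulz (A0 : zmodType) (u : prodZ A0) m :
  u *~ m = (u.1 *~ m, u.2 *~ m) :> prodZ A0.
Proof.
rewrite [LHS]surjective_pairing; congr (_, _).
  exact: (raddfMz (fst : prodZ A0 -> A0)).
exact: (raddfMz (snd : prodZ A0 -> int)).
Qed.

(** The integers [m] with [x *~ m] in [S] form an ideal; [n] is its least positive element if there
    is one, and 0 otherwise. *)
Lemma exists_order : exists n : int,
  x *~ n \in S /\ forall m, x *~ m \in S -> exists q, m = n *~ q.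
Proof.
have [ex|no] := pselect (exists n : nat, x *~ n.+1%:Z \in S); last first.
  exists 0; split=> [|m Sm]; first exact: rpred0.
  exists 0; rewrite mulr0z; case: m Sm => [[|m]|m] // Sm;
    case: no; exists m => //.
  by rewrite -rpredN -mulrNz -NegzE.
case: (ex_minnP ex) => n Sn n_min; exists n.+1%:Z; split=> // m Sm.
exists (m %/ n.+1%:Z)%Z; rewrite mulrzz mulrC {1}(divz_eq m n.+1).
suff -> : (m %% n.+1)%Z = 0 by rewrite addr0.
have Sr : x *~ (m %% n.+1)%Z \in S.
  have -> : (m %% n.+1)%Z = m - n.+1%:Z * (m %/ n.+1)%Z.
    by rewrite {2}(divz_eq m n.+1) (mulrC n.+1%:Z) addrC addKr.
  by rewrite mulrzBr rpredB // mulrzA rpredMz.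
have := modz_ge0 m (isT : n.+1%:Z != 0).
have := ltz_pmod m (isT : 0 < n.+1%:Z).
case: (m %% n.+1)%Z Sr => [[|r]|r] Sr lt_r ge0_r //.
by have := n_min r Sr; rewrite leqNgt -ltnS -ltz_nat lt_r.
Qed.

End Subgroup.

Lemma int_parity (m : int) : exists p, m = p + p \/ m = p + p + 1.
Proof.
exists (m %/ 2)%Z; have e : m = (m %/ 2)%Z + (m %/ 2)%Z + (m %% 2)%Z.
  by rewrite {1}(divz_eq m 2) mulr_natr mulr2n.
have := modz_ge0 m (isT : 2 != 0 :> int).
have := ltz_pmod m (isT : 0 < 2 :> int).
by case: (m %% 2)%Z e => [[|[|]]|] // e _ _; [left; rewrite {1}e addr0|right].
Qed.

Definition double (A : zmodType) (x : A) := exists w, x = w + w.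

(** * Maximal partial trivializations *)

Section Trivialization.
Variables (A B : zmodType) (h : A -> A -> A -> B) (c : A -> A -> B).
Hypotheses (hc : sym_cocycle h c) (h0 : normalized h).

(** [k] is a total function, but only its values on [S] matter. [partial_alt] is the invariant that
    lets the extension step be repeated. *)
Record partial_trivializer (S : set A) (k : A -> A -> B) : Prop := {
  partial_0 : S 0;
  partial_B : forall x y, S x -> S y -> S (x - y);
  partial_k0 : k 0 0 = 0;
  partial_triv : forall x y z, S x -> S y -> S z -> twist h k x y z = 0;
  partial_alt : forall x y, S x -> S y -> double x -> alt c k x y = 0
}.

Lemma extend_partial (S : set A) k x : partial_trivializer S k ->
  double x \/ (forall s, S s -> ~ double (x - s)) ->
  exists S' k', [/\ partial_trivializer S' k', S `<=` S', S' x
    & forall a b, S a -> S b -> k' a b = k a b].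
Proof.
move=> Sk x_double.
have S_closed : zmod_closed (fun a => `[< S a >]).
  split=> [|a b /asboolP Sa /asboolP Sb]; apply/asboolP.
    exact: partial_0 Sk.
  exact: (partial_B Sk).
have [Sb SbE] : exists Sb : zmodClosed A, forall a, (a \in Sb) = `[< S a >].
  pose Sb : zmodClosed A :=
    HB.pack (fun a => `[< S a >]) (GRing.isZmodClosed.Build A _ S_closed).
  by exists Sb.
pose p : {additive prodZ (subgroup Sb) -> A} := @adjoin A Sb x.
have Sval (a : subgroup Sb) : S (val a).
  by apply/asboolP; rewrite -SbE; exact: valP a.
pose hp u v w := h (p u) (p v) (p w).
pose cp u v := c (p u) (p v).
have hcp : sym_cocycle hp cp by exact: sym_cocycle_pullback.
have hp0 : normalized hp by move=> u v; rewrite /hp raddf0 h0.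
pose k0 (a b : subgroup Sb) := k (val a) (val b).
have pE a m : p (a, m) = val a + x *~ m by [].
have pA a : p (inA a) = val a by rewrite /p /= /adjoin mulr0z addr0.
have pZ m : p (inZ m) = x *~ m by rewrite /p /= /adjoin add0r.
have [|a b d|k1 [hk1 k1A k1Z]] := @extend_by_int _ _ hp cp k0 hcp hp0.
- exact: partial_k0 Sk.
- by rewrite /hp !pA; apply: (partial_triv Sk).
have hc1 := twist_cocycle k1 hcp.
pose f := alt cp k1.
(* This serves twice: 0 is a double, so [f] vanishes on the kernel of [p] and descent applies; on
   the image of [p] it becomes [partial_alt]. *)
have f_double u v : double (p u) -> f u v = 0.
  case: u v => a m [b l]; rewrite -!inAZ raddfD pA pZ => [[w am_w]].
  (* If [x] is a double, so is [a], and [c x x = 0]. Otherwise an odd [m] would make [x + a] a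
     double, which is excluded; for even [m], [a] is a double and [2 c(x, x) = 0]. *)
  have [a_double cm] : double (val a) /\ c x x *~ m = 0.
    case: x_double => [[y xy]|x_odd].
      split; last by rewrite xy (sym_double _ hc) mul0rz.
      exists (w - y *~ m); apply: (addIr (x *~ m)); rewrite am_w xy mulrzDl; zmod.
    have [q [mE|mE]] := int_parity m; rewrite mE !mulrzDr in am_w *.
      split; first by exists (w - x *~ q); apply: (addIr (x *~ q + x *~ q));
        rewrite am_w; zmod.
      by rewrite -mulrzDl (sym_invol hc) mul0rz.
    case: (x_odd (- val a)).
      rewrite -[- val a]add0r; apply: (partial_B Sk) => //.
      exact: partial_0 Sk.
    exists (w - x *~ q); rewrite mulr1z in am_w.
    by apply: (zm_lincomb am_w); zmod.
  have fD := (sym_bilin_l hc1 hk1, sym_bilin_r hc1 hk1).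
  have fA : f (inA a) (inA b) = alt c k (val a) (val b).
    by rewrite /f /alt /cp !pA !k1A.
  have fAZ : f (inA a) (inZ l) = 0.
    by apply: (zm_lincomb (sym_invol hc1 (inZ l) (inA a))); rewrite k1Z /f; zmod.
  have inZE n : inZ n = inZ 1 *~ n :> prodZ (subgroup Sb).
    by rewrite prodZ_mulz /= mul0rz intz.
  have fZ : f (inZ m) (inZ l) = 0.
    rewrite (inZE m) (inZE l) /f (sym_bilinz_r hc1 hk1) (sym_bilinz_l hc1 hk1).
    by rewrite alt_diag /cp pZ mulr1z cm mul0rz.
  rewrite /f !fD -/f fA fAZ fZ [f (inZ m) (inA b)]k1Z (partial_alt Sk) //; zmod.
have [n [Sn n_gen]] := exists_order Sb x.
pose sub_in a (Sa : a \in Sb) : subgroup Sb := exist (fun b => b \in Sb) a Sa.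
have Sn' : - (x *~ n) \in Sb by rewrite rpredN.
(* The kernel of [p] consists of the pairs [(- (x *~ m), m)] with [x *~ m] in [S]; the pair for
   [m = n] generates it. *)
pose u0 : prodZ (subgroup Sb) := (sub_in _ Sn', n).
have [||||||k' [hk' alt_k' k'A]] := @descend_trivializer _ _ _ p h c k1 u0 hc h0.
- by have := k1A 0 0; rewrite inA0 => ->; exact: partial_k0 Sk.
- exact: hk1.
- by rewrite /p /= /adjoin /= addNr.
- have [n0|] := eqVneq n 0; [left|by right].
  rewrite /u0; congr (_, _) => //; apply: val_inj; by rewrite /= n0 mulr0z oppr0.
- case=> a m; rewrite pE => am0.
  have aE : val a = - (x *~ m) by apply: (zm_lincomb am0); zmod.
  have [|q mE] := n_gen m.
    by rewrite -[x *~ m]opprK -aE rpredN SbE; apply/asboolP.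
  exists q; rewrite prodZ_mulz /=; congr (_, _) => //; apply: val_inj.
  by rewrite (raddfMz (val : subgroup Sb -> A)) /= aE mE mulNrz -mulrzA mulrzz.
- move=> u v pu; apply: f_double; rewrite pu; exists 0; by rewrite addr0.
exists (range p), k'; split.
- split.
  + by exists 0 => //; rewrite raddf0.
  + by move=> _ _ [u _ <-] [v _ <-]; exists (u - v) => //; rewrite raddfB.
  + have := k'A 0 0; rewrite k1A inA0 raddf0 => ->; exact: partial_k0 Sk.
  + by move=> _ _ _ [u _ <-] [v _ <-] [w _ <-].
  + by move=> _ _ [u _ <-] [v _ <-] pu; rewrite alt_k'; exact: f_double.
- move=> s Ss; have Ss' : s \in Sb by rewrite SbE; apply/asboolP.
  by exists (inA (sub_in s Ss')) => //; rewrite pA.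
- by exists (inZ 1) => //; rewrite pZ mulr1z.
- move=> a b Sa Sb'.
  have Sa' : a \in Sb by rewrite SbE; apply/asboolP.
  have Sb'' : b \in Sb by rewrite SbE; apply/asboolP.
  have := k'A (sub_in a Sa') (sub_in b Sb'').
  by rewrite !pA k1A.
Qed.

(** Any three elements of the union lie in a common member of the chain, so each condition is
    checked inside one member. *)
Lemma partial_chain (F : set (set A * (A -> A -> B))) :
  (forall t, F t -> partial_trivializer t.1 t.2) -> F !=set0 ->
  (forall s t, F s -> F t ->
    (s.1 `<=` t.1 /\ forall a b, s.1 a -> s.1 b -> t.2 a b = s.2 a b) \/
    (t.1 `<=` s.1 /\ forall a b, t.1 a -> t.1 b -> s.2 a b = t.2 a b)) ->
  exists S k, partial_trivializer S k /\ forall t, F t ->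
    t.1 `<=` S /\ forall a b, t.1 a -> t.1 b -> k a b = t.2 a b.
Proof.
move=> Fpart [t0 Ft0] Ftot.
(* The members of the chain agree where they overlap; pairs contained in no member get the value
   0. *)
have /choice[k kP] : forall ab : A * A, exists v, forall t, F t ->
    t.1 ab.1 -> t.1 ab.2 -> v = t.2 ab.1 ab.2.
  move=> [a b].
  have [[t [Ft ta tb]]|no] := pselect (exists t, [/\ F t, t.1 a & t.1 b]).
    exists (t.2 a b) => s Fs /= sa sb.
    by have [[_ e]|[_ e]] := Ftot _ _ Ft Fs; rewrite e.
  by exists 0 => t Ft ta tb; case: no; exists t.
pose S := \bigcup_(t in F) t.1.
have common x y : S x -> S y -> exists t, [/\ F t, t.1 x & t.1 y].
  move=> [s Fs sx] [t Ft ty].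
  have [[le_st _]|[le_ts _]] := Ftot _ _ Fs Ft.
    by exists t; split=> //; apply: le_st.
  by exists s; split=> //; apply: le_ts.
have common3 x y z : S x -> S y -> S z ->
    exists t, [/\ F t, t.1 x, t.1 y & t.1 z].
  move=> Sx Sy [s Fs sz]; have [t [Ft tx ty]] := common _ _ Sx Sy.
  have [[le_st _]|[le_ts _]] := Ftot _ _ Fs Ft.
    by exists t; split=> //; apply: le_st.
  by exists s; split=> //; apply: le_ts.
have S_D t x y : F t -> t.1 x -> t.1 y -> t.1 (x + y).
  move=> Ft tx ty; have [t_0 t_B _ _ _] := Fpart _ Ft.
  by rewrite -[y]opprK -[- y]add0r; do 2!apply: (t_B) => //.
have kE t a b : F t -> t.1 a -> t.1 b -> k (a, b) = t.2 a b.
  by move=> Ft ta tb; rewrite (kP (a, b) t).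
exists S, (fun a b => k (a, b)); split; last first.
  by move=> t Ft; split=> [a ta|a b ta tb]; [exists t|exact: kE].
split.
- by exists t0 => //; case: (Fpart _ Ft0).
- move=> x y Sx Sy; have [t [Ft tx ty]] := common _ _ Sx Sy.
  have [_ t_B _ _ _] := Fpart _ Ft.
  by exists t => //; exact: t_B.
- have [t_0 _ t_k0 _ _] := Fpart _ Ft0.
  by rewrite (kE t0).
- move=> x y z Sx Sy Sz; have [t [Ft tx ty tz]] := common3 _ _ _ Sx Sy Sz.
  have [_ _ _ t_triv _] := Fpart _ Ft.
  by rewrite /twist /cob !(kE t) //; do ?exact: S_D; exact: t_triv.
- move=> x y Sx Sy; have [t [Ft tx ty]] := common _ _ Sx Sy.
  have [_ _ _ _ t_alt] := Fpart _ Ft.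
  by rewrite /alt !(kE t) //; exact: t_alt.
Qed.

(** Zorn's lemma for a preorder: [R] compares cochains on the smaller subgroup only, so it is not
    antisymmetric. *)
Lemma normalized_trivializer : exists k, forall x y z, twist h k x y z = 0.
Proof.
pose T := {t : set A * (A -> A -> B) | partial_trivializer t.1 t.2}.
pose R (s t : T) := `[< (sval s).1 `<=` (sval t).1 /\ forall a b,
  (sval s).1 a -> (sval s).1 b -> (sval t).2 a b = (sval s).2 a b >].
have part0 : partial_trivializer [set 0] (fun _ _ => 0).
  split=> // [x y -> ->|x y z -> -> ->|x y -> -> _].
  - by rewrite subr0.
  - by rewrite /twist /cob h0; zmod.
  - by rewrite /alt (sym_r0 hc h0); zmod.
pose t0 : T := exist (fun t => partial_trivializer t.1 t.2) (_, _) part0.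
have [|r s t /asboolP[rs krs] /asboolP[st kst]|F Ftot|[[S k] /= Sk] S_max] :=
  ZL_preorder t0 (R := R).
- by move=> t; apply/asboolP; split.
- apply/asboolP; split=> [a /rs/st//|a b ra rb].
  have [sa sb] := (rs _ ra, rs _ rb).
  by rewrite kst // krs.
- have [F0|noF] := pselect (F !=set0); last first.
    by exists t0 => s Fs; case: noF; exists s.
  have [_ [t _ <-]||_ _ [s Fs <-] [t Ft <-]|S [k [Sk SkP]]] :=
    @partial_chain [set sval t | t in F].
  + exact: (svalP t).
  + by have [t Ft] := F0; exists (sval t), t.
  + by have [/asboolP|/asboolP] := Ftot _ _ Fs Ft; [left|right].
  exists (exist (fun t => partial_trivializer t.1 t.2) (S, k) Sk) => t Ft.
  by apply/asboolP; apply: SkP; exists t.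
have extE x : double x \/ (forall s, S s -> ~ double (x - s)) -> S x.
  move=> /(extend_partial Sk)[S' [k' [Sk' SS' S'x k'E]]].
  pose t' : T := exist (fun t => partial_trivializer t.1 t.2) (S', k') Sk'.
  have /asboolP[le_S'S _] : R t' (exist _ (S, k) Sk).
    by apply: S_max; apply/asboolP.
  exact: le_S'S.
(* Maximality puts every double in [S], hence all of [S + 2 A]; an element outside [S + 2 A] could
   be adjoined as well. *)
have S_all x : S x.
  have [[s Ss [w xs_w]]|no] := pselect (exists2 s, S s & double (x - s)).
    have [S0 S_B _ _ _] := Sk.
    have Sww : S (w + w) by apply: extE; left; exists w.
    rewrite -(subrK s x) xs_w -[s]opprK -[- s]add0r.
    by do 2!apply: (S_B) => //.
  by apply: extE; right=> s Ss xs; case: no; exists s.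
by exists k => x y z; apply: (partial_triv Sk).
Qed.

End Trivialization.

Theorem sym_cocycle_trivial (A B : zmodType) (h : A -> A -> A -> B)
    (c : A -> A -> B) :
  sym_cocycle h c -> exists k, forall x y z, twist h k x y z = 0.
Proof.
move=> hc; have [k h0] := exists_normalized hc.
have [k' hk'] := normalized_trivializer (twist_cocycle k hc) h0.
by exists (fun x y => k x y + k' x y) => x y z; rewrite -twist_twist.
Qed.

(** * Scalars in a Picard groupoid *)

Local Open Scope cat_scope.

Section Groupoid.
Variables (C : Category) (gC : groupoid C).

Definition ginv (x y : C) (f : x ~> y) : y ~> x := sval (cid (gC f)).

Lemma ginvL (x y : C) (f : x ~> y) : ginv f ∘ f = idm x.
Proof. by rewrite /ginv; case: cid => g []. Qed.

Lemma ginvR (x y : C) (f : x ~> y) : f ∘ ginv f = idm y.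
Proof. by rewrite /ginv; case: cid => g []. Qed.

Lemma comp_injl (x y z : C) (f : y ~> z) (g g' : x ~> y) :
  f ∘ g = f ∘ g' -> g = g'.
Proof.
move=> e; rewrite -(comp_idl g) -(comp_idl g') -(ginvL f).
by rewrite -!comp_assoc e.
Qed.

Lemma comp_injr (x y z : C) (f : x ~> y) (g g' : y ~> z) :
  g ∘ f = g' ∘ f -> g = g'.
Proof.
move=> e; rewrite -(comp_idr g) -(comp_idr g') -(ginvR f).
by rewrite !comp_assoc e.
Qed.

Lemma isomorphic_sym (x y : C) : isomorphic x y -> isomorphic y x.
Proof. by case=> f _; exists (ginv f). Qed.

Lemma isomorphic_trans (x y z : C) :
  isomorphic x y -> isomorphic y z -> isomorphic x z.
Proof. by case=> f _ [g _]; exists (g ∘ f). Qed.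

End Groupoid.

Section Picard.
Variables (C : SymMonCat) (pC : picard C).
Let gC : groupoid C := proj1 pC.
Let I : C := unit_obj.

Lemma tensm_lr (x x' y y' : C) (f : x ~> x') (g : y ~> y') :
  (f ⊕m idm y') ∘ (idm x ⊕m g) = f ⊕m g.
Proof. by rewrite -tensm_comp comp_idl comp_idr. Qed.

Lemma tensm_rl (x x' y y' : C) (f : x ~> x') (g : y ~> y') :
  (idm x' ⊕m g) ∘ (f ⊕m idm y) = f ⊕m g.
Proof. by rewrite -tensm_comp comp_idl comp_idr. Qed.

(** The scalar [b] acts on [x] as the conjugate of [b ⊕m idm x] by [lunit x]; the opaque proof
    leaves only this equation visible. *)
Fact act_key (b : I ~> I) (x : C) :
  {f : x ~> x | f ∘ lunit x = lunit x ∘ (b ⊕m idm x)}.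
Proof.
exists (lunit x ∘ (b ⊕m idm x) ∘ ginv gC (lunit x)).
by rewrite -comp_assoc ginvL comp_idr.
Qed.

Definition act b x := sval (act_key b x).

Lemma act_lunit b x : act b x ∘ lunit x = lunit x ∘ (b ⊕m idm x).
Proof. exact: (svalP (act_key b x)). Qed.

Lemma act_nat b (x y : C) (f : x ~> y) : f ∘ act b x = act b y ∘ f.
Proof.
apply: (comp_injr gC (f := lunit x)); rewrite -!comp_assoc act_lunit.
rewrite [LHS]comp_assoc -lunit_nat -comp_assoc tensm_rl.
by rewrite [RHS]comp_assoc act_lunit -comp_assoc tensm_lr.
Qed.

Lemma act_comp b b' x : act (b ∘ b') x = act b x ∘ act b' x.
Proof.
apply: (comp_injr gC (f := lunit x)).
rewrite -comp_assoc !act_lunit comp_assoc act_lunit -comp_assoc -tensm_comp.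
by rewrite comp_idl.
Qed.

(* Eckmann-Hilton: scalars act centrally, and on the unit object every
   endomorphism is a scalar. *)
Lemma unit_comm (b b' : I ~> I) : b ∘ b' = b' ∘ b.
Proof.
(* By naturality of both unitors, conjugation by [th] turns [b1] into its action on [I]. *)
pose th : I ~> I := lunit I ∘ ginv gC (runit I).
have th_act b1 : act b1 I ∘ th = th ∘ b1.
  rewrite /th comp_assoc act_lunit -!comp_assoc; congr (_ ∘ _).
  apply: (comp_injl gC (f := runit I)).
  by rewrite !comp_assoc runit_nat ginvR comp_idl -comp_assoc ginvR comp_idr.
have -> : b = act (ginv gC th ∘ b ∘ th) I.
  apply: (comp_injr gC (f := th)).
  by rewrite th_act !comp_assoc ginvR comp_idl.
by rewrite act_nat.
Qed.

(** Tensoring with [x] and then with an inverse [y] is naturally isomorphic to the identity; this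
    makes tensoring with [x] fully faithful. *)
Lemma exists_collapse (x : C) :
  exists (y : C) (col : forall a : C, (a ⊕ x) ⊕ y ~> a),
  forall (a b : C) (f : a ~> b),
    col b ∘ ((f ⊕m idm x) ⊕m idm y) = f ∘ col a.
Proof.
have [y [e _]] := (proj2 pC) x.
exists y, (fun a => runit a ∘ (idm a ⊕m (e ∘ symm x y)) ∘ assoc a x y).
move=> a b f; rewrite -comp_assoc assoc_nat tensm_id comp_assoc.
rewrite -[X in X ∘ _](comp_assoc (runit b)) tensm_rl.
by rewrite -tensm_lr comp_assoc runit_nat !comp_assoc.
Qed.

Lemma rtens_inj (x a b : C) (f g : a ~> b) :
  f ⊕m idm x = g ⊕m idm x -> f = g.
Proof.
have [y [col colE]] := exists_collapse x.
by move=> fg; apply: (comp_injr gC (f := col a)); rewrite -!colE fg.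
Qed.

(** Collapsing [g ⊕m idm y] yields an [f] that is correct after tensoring with [y], hence correct by
    faithfulness. *)
Lemma rtens_full (x a b : C) (g : a ⊕ x ~> b ⊕ x) :
  exists f, f ⊕m idm x = g.
Proof.
have [y [col colE]] := exists_collapse x.
exists (col b ∘ (g ⊕m idm y) ∘ ginv gC (col a)).
apply: (@rtens_inj y); apply: (comp_injl gC (f := col b)).
by rewrite colE -!comp_assoc ginvL comp_idr.
Qed.

Lemma act_inj b b' x : act b x = act b' x -> b = b'.
Proof.
move=> bb'; apply: (@rtens_inj x); apply: (comp_injl gC (f := lunit x)).
by rewrite -!act_lunit bb'.
Qed.

Lemma act_full x (f : x ~> x) : exists b, f = act b x.
Proof.
have [b bP] := rtens_full (ginv gC (lunit x) ∘ f ∘ lunit x).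
exists b; apply: (comp_injr gC (f := lunit x)).
by rewrite act_lunit bP !comp_assoc ginvR comp_idl.
Qed.

(* Instead of Kelly's coherence [lunit (x ⊕ y) ∘ assoc I x y = lunit x ⊕m idm y]
   it suffices that the two sides differ by an automorphism, since scalars are
   central. *)
Lemma act_tensl b (x y : C) : act b x ⊕m idm y = act b (x ⊕ y).
Proof.
pose be := (b ⊕m idm x) ⊕m idm y.
have [X PX] : exists X : (I ⊕ x) ⊕ y ~> x ⊕ y, act b (x ⊕ y) ∘ X = X ∘ be.
  exists (lunit (x ⊕ y) ∘ assoc I x y).
  rewrite comp_assoc act_lunit -!comp_assoc; congr (_ ∘ _).
  by rewrite /be assoc_nat tensm_id.
have [Y QY] : exists Y : (I ⊕ x) ⊕ y ~> x ⊕ y,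
    (act b x ⊕m idm y) ∘ Y = Y ∘ be.
  exists (lunit x ⊕m idm y).
  by rewrite /be -!tensm_comp !comp_idl act_lunit.
have PXY : act b (x ⊕ y) ∘ (X ∘ ginv gC Y) =
    (X ∘ ginv gC Y) ∘ (act b x ⊕m idm y).
  apply: (comp_injr gC (f := Y)); rewrite -!comp_assoc QY ginvL comp_idr PX.
  by rewrite (comp_assoc (ginv gC Y)) ginvL comp_idl.
by apply: (comp_injl gC (f := X ∘ ginv gC Y)); rewrite -PXY act_nat.
Qed.

Lemma act_tensr b (x y : C) : idm x ⊕m act b y = act b (x ⊕ y).
Proof.
apply: (comp_injl gC (f := symm x y)).
by rewrite symm_nat act_tensl act_nat.
Qed.

End Picard.

(** * Classes and values *)

(** [pC] is a parameter of the type because the group structure attached to it is built from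
    [pC]. *)
Definition pi1 (C : SymMonCat) (pC : picard C) : Type :=
  (unit_obj : C) ~> unit_obj.

Section Pi1.
Variables (C : SymMonCat) (pC : picard C).
Local Notation P1 := (pi1 pC).
Implicit Types b : P1.

Let add b b' : P1 := b ∘ b'.
Let opp b : P1 := ginv (proj1 pC) b.

Fact pi1_addA : associative add. Proof. exact: comp_assoc. Qed.
Fact pi1_addC : commutative add. Proof. exact: unit_comm. Qed.
Fact pi1_add0 : left_id (idm _ : P1) add. Proof. exact: comp_idl. Qed.
Fact pi1_addN : left_inverse (idm _ : P1) opp add. Proof. exact: ginvL. Qed.

HB.instance Definition _ := gen_eqMixin P1.
HB.instance Definition _ := gen_choiceMixin P1.
HB.instance Definition _ :=
  GRing.isZmodule.Build P1 pi1_addA pi1_addC pi1_add0 pi1_addN.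

End Pi1.

(* Isomorphism classes, each being the predicate of its members. *)
Definition pi0 (C : SymMonCat) (pC : picard C) : Type :=
  {S : C -> Prop | exists x, S = isomorphic x}.

Section Pi0.
Variables (C : SymMonCat) (pC : picard C).
Local Notation P0 := (pi0 pC).
Let gC : groupoid C := proj1 pC.

Definition cls (x : C) : P0 :=
  exist (fun S => exists x, S = isomorphic x) (isomorphic x) (ex_intro _ x erefl).

Lemma cls_eq (x y : C) : isomorphic x y -> cls x = cls y.
Proof.
move=> xy; apply: eq_exist; apply/funext => z; apply/propext; split.
  by apply: (isomorphic_trans gC); apply: isomorphic_sym.
exact: isomorphic_trans.
Qed.

Lemma hom_cls (x y : C) (f : x ~> y) : cls x = cls y.
Proof. by apply: cls_eq; exists f. Qed.

Lemma cls_hom (x y : C) : cls x = cls y -> exists f : x ~> y, True.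
Proof.
move=> /(congr1 sval) /= e.
have : isomorphic y y by exists (idm y); exists (idm y); rewrite comp_idl.
by rewrite -e => -[f _]; exists f.
Qed.

Definition rep (a : P0) : C := sval (cid (svalP a)).

Lemma repK a : cls (rep a) = a.
Proof.
by case: a => S ?; apply: eq_exist; rewrite /rep; case: cid => x /= ->.
Qed.

Let add (a b : P0) : P0 := cls (rep a ⊕ rep b).
Let opp (a : P0) : P0 := cls (sval (cid (proj2 pC (rep a)))).

Lemma cls_tens (x y : C) : cls (x ⊕ y) = add (cls x) (cls y).
Proof.
have [f _] := cls_hom (esym (repK (cls x))).
have [g _] := cls_hom (esym (repK (cls y))).
exact: hom_cls (f ⊕m g).
Qed.

Fact pi0_addA : associative add.
Proof.
move=> a b c; rewrite -(repK a) -(repK b) -(repK c) -!cls_tens.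
exact/esym/hom_cls/assoc.
Qed.

Fact pi0_addC : commutative add.
Proof.
by move=> a b; rewrite -(repK a) -(repK b) -!cls_tens; exact/hom_cls/symm.
Qed.

Fact pi0_add0 : left_id (cls unit_obj) add.
Proof. by move=> a; rewrite -(repK a) -cls_tens; exact/hom_cls/lunit. Qed.

Fact pi0_addN : left_inverse (cls unit_obj) opp add.
Proof.
move=> a; rewrite -{2}(repK a) -cls_tens.
by case: cid => y /= [f _]; exact: hom_cls f.
Qed.

HB.instance Definition _ := gen_eqMixin P0.
HB.instance Definition _ := gen_choiceMixin P0.
HB.instance Definition _ :=
  GRing.isZmodule.Build P0 pi0_addA pi0_addC pi0_add0 pi0_addN.

Lemma clsD (x y : C) : cls x + cls y = cls (x ⊕ y).
Proof. by rewrite cls_tens. Qed.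

Lemma cls0 : cls unit_obj = 0. Proof. by []. Qed.

End Pi0.

Section Value.
Variables (C : SymMonCat) (pC : picard C).
Local Notation P0 := (pi0 pC).
Local Notation P1 := (pi1 pC).
Local Notation cls := (cls pC).
Let gC : groupoid C := proj1 pC.

Lemma ex_iota (a : P0) (x : C) : cls x = a -> exists f : x ~> rep a, True.
Proof. by move=> xa; apply: (@cls_hom _ pC); rewrite repK. Qed.

(** The class is a variable with an equation, so that equal classes are substituted without
    transporting morphisms. *)
Definition iota (a : P0) (x : C) (p : cls x = a) : x ~> rep a :=
  sval (cid (ex_iota p)).

(** Conjugating [f] by [iota] gives an automorphism of the common representative, which is a scalar
    by [act_full]. *)
Fact ex_value (x y : C) (f : x ~> y) : exists b : P1,
  forall a (p : cls x = a) (q : cls y = a),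
    iota q ∘ f = act pC b (rep a) ∘ iota p.
Proof.
have p := hom_cls pC f.
have [b bP] := act_full pC (iota (erefl (cls y)) ∘ f ∘ ginv gC (iota p)).
exists b => a p' q; case: _ / q in p' *.
by rewrite -bP (Prop_irrelevance p' p) -comp_assoc ginvL comp_idr.
Qed.

Definition value (x y : C) (f : x ~> y) : P1 := sval (cid (ex_value f)).

Lemma valueP (x y : C) (f : x ~> y) a (p : cls x = a) (q : cls y = a) :
  iota q ∘ f = act pC (value f) (rep a) ∘ iota p.
Proof. by rewrite /value; case: cid => b /= ->. Qed.

Lemma value_uniq (x y : C) (f : x ~> y) a (p : cls x = a) (q : cls y = a) b :
  iota q ∘ f = act pC b (rep a) ∘ iota p -> value f = b.
Proof.
rewrite (valueP f p q) => /(comp_injr gC); exact: act_inj.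
Qed.

Lemma value_comp (x y z : C) (g : y ~> z) (f : x ~> y) :
  value (g ∘ f) = value g + value f.
Proof.
pose r := erefl (cls z); pose q := hom_cls pC g; pose p := hom_cls pC (g ∘ f).
apply: (@value_uniq _ _ _ _ p r).
rewrite comp_assoc (valueP g q r) -comp_assoc (valueP f p q).
by rewrite comp_assoc -act_comp.
Qed.

Lemma value_id (x : C) : value (idm x) = 0.
Proof. by apply: (addrI (value (idm x))); rewrite -value_comp comp_idl addr0. Qed.

Lemma value_act b (x : C) : value (act pC b x) = b.
Proof. by apply: (@value_uniq _ _ _ _ (erefl _) (erefl _)); rewrite act_nat. Qed.

Lemma value_inj (x y : C) (f g : x ~> y) : value f = value g -> f = g.
Proof.
move=> fg; pose q := erefl (cls y); pose p := hom_cls pC f.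
apply: (comp_injl gC (f := iota q)).
by rewrite (valueP f p q) (valueP g p q) fg.
Qed.

Lemma value_surj (x y : C) b : cls x = cls y -> exists f : x ~> y, value f = b.
Proof.
move=> /cls_hom[f _]; exists (act pC (b - value f) y ∘ f).
by rewrite value_comp value_act subrK.
Qed.

(* [value] is a functor to [pi1]; [defect] measures how far it is from being
   compatible with [⊕]. *)
Definition defect (x y : C) : P1 :=
  value (iota (erefl (cls x)) ⊕m iota (erefl (cls y))).

(** Tensor the equations that define the two values; scalars pass through [⊕] by [act_tensl] and
    [act_tensr]. *)
Lemma value_tens (x x' y y' : C) (f : x ~> x') (g : y ~> y') :
  value (f ⊕m g) = value f + value g + defect x y - defect x' y'.
Proof.
have p := hom_cls pC f; have q := hom_cls pC g.
have e := tensm_comp (iota (erefl (cls x'))) f (iota (erefl (cls y'))) g.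
have dE : value (iota p ⊕m iota q) = defect x y.
  rewrite /defect; move: (cls x') (cls y') p q {e} => a b p q.
  by case: _ / p; case: _ / q.
move: e; rewrite (valueP f p) (valueP g q) tensm_comp.
rewrite -tensm_lr act_tensl act_tensr.
move/(congr1 (@value _ _)).
rewrite !value_comp !value_act dE -/(defect x' y') => e.
by apply: (zm_lincomb (esym e)); zmod.
Qed.

End Value.

(** * The skeletal model *)

Section AssociatorCocycle.
Variables (C : SymMonCat) (pC : picard C).
Local Notation P0 := (pi0 pC).
Local Notation P1 := (pi1 pC).
Local Notation cls := (cls pC).
Local Notation value := (value pC).
Local Notation defect := (defect pC).

(** The associator seen through the chosen isomorphisms. The defects cancel those arising from
    naturality, so that only the classes of [x], [y], [z] matter. *)
Let assoc_val (x y z : C) : P1 :=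
  value (assoc x y z)
  + (defect y z - defect (x ⊕ y) z + defect x (y ⊕ z) - defect x y).

Let symm_val (x y : C) : P1 := value (symm x y) - defect x y + defect y x.

Lemma assoc_val_cls (x y z : C) :
  assoc_val (rep (cls x)) (rep (cls y)) (rep (cls z)) = assoc_val x y z.
Proof.
have [f _] := cls_hom (repK (cls x)).
have [g _] := cls_hom (repK (cls y)).
have [h _] := cls_hom (repK (cls z)).
have := congr1 (value (y := _)) (assoc_nat f g h).
rewrite !value_comp !value_tens /assoc_val => e.
by apply: (zm_lincomb (esym e)); zmod.
Qed.

Lemma symm_val_cls (x y : C) :
  symm_val (rep (cls x)) (rep (cls y)) = symm_val x y.
Proof.
have [f _] := cls_hom (repK (cls x)).
have [g _] := cls_hom (repK (cls y)).
have := congr1 (value (y := _)) (symm_nat f g).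
rewrite !value_comp !value_tens /symm_val => e.
by apply: (zm_lincomb (esym e)); zmod.
Qed.

Lemma picard_cocycle :
  sym_cocycle (fun a b c : P0 => assoc_val (rep a) (rep b) (rep c))
    (fun a b : P0 => symm_val (rep a) (rep b)).
Proof.
split=> [a b c d|a b c|a b].
- rewrite -(repK a) -(repK b) -(repK c) -(repK d) !clsD !assoc_val_cls.
  set w := rep a; set x := rep b; set y := rep c; set z := rep d.
  have := congr1 (value (y := _)) (pentagon w x y z).
  rewrite !value_comp !value_tens !value_id /assoc_val => e.
  by apply: (zm_lincomb e); zmod.
- rewrite -(repK a) -(repK b) -(repK c) !clsD !assoc_val_cls !symm_val_cls.
  set x := rep a; set y := rep b; set z := rep c.
  have := congr1 (value (y := _)) (hexagon x y z).
  rewrite !value_comp !value_tens !value_id /assoc_val /symm_val => e.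
  by apply: (zm_lincomb e); zmod.
- have := congr1 (value (y := _)) (symm_invol (rep a) (rep b)).
  rewrite value_comp value_id /symm_val => e.
  by apply: (zm_lincomb e); zmod.
Qed.

(** Correcting [defect] by a trivialization of the cocycle leaves an associator that is a pure
    coboundary in [T], and a bilinear symmetry [s]. *)
Lemma exists_strict_defect :
  exists (T : C -> C -> P1) (s : P0 -> P0 -> P1) (e : P1),
  [/\ [/\ forall (x x' y y' : C) (f : x ~> x') (g : y ~> y'),
        value (f ⊕m g) = value f + value g + T x y - T x' y',
      forall x y z, value (assoc x y z) =
        T (x ⊕ y) z + T x y - T y z - T x (y ⊕ z),
      forall x y, value (symm x y) = s (cls x) (cls y) + T x y - T y x,
      forall x, value (lunit x) = e + T unit_obj x
    & forall x, value (runit x) = e + T x unit_obj],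
      forall a b c, s a (b + c) = s a b + s a c
    & forall a b, s b a + s a b = 0].
Proof.
have hc := picard_cocycle; have [k hk] := sym_cocycle_trivial hc.
have hc' := twist_cocycle k hc.
pose T x y := defect x y + k (cls x) (cls y).
have T_tens (x x' y y' : C) (f : x ~> x') (g : y ~> y') :
    value (f ⊕m g) = value f + value g + T x y - T x' y'.
  by rewrite value_tens /T (hom_cls pC f) (hom_cls pC g); zmod.
have T_assoc x y z : value (assoc x y z) =
    T (x ⊕ y) z + T x y - T y z - T x (y ⊕ z).
  have := hk (cls x) (cls y) (cls z).
  rewrite /twist /cob !clsD assoc_val_cls /assoc_val => e.
  by apply: (zm_lincomb e); rewrite /T; zmod.
(* By the triangle a function of [y] equals a function of [x], so both are one constant, taken as
   [e] below. *)
have T_unit x y :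
    value (lunit y) - T unit_obj y = value (runit x) - T x unit_obj.
  have := congr1 (value (y := _)) (triangle x y).
  rewrite value_comp !T_tens !value_id T_assoc => e.
  by apply: (zm_lincomb e); zmod.
exists T, (alt (fun a b : P0 => symm_val (rep a) (rep b)) k).
exists (value (lunit unit_obj) - T unit_obj unit_obj).
split; [split|exact: sym_bilin_r hc' hk|exact: sym_invol hc'] => //.
- move=> x y; rewrite /alt symm_val_cls /symm_val /T; zmod.
- move=> x; rewrite (T_unit unit_obj) -(T_unit _ x) subrK //.
- move=> x; rewrite (T_unit x) subrK //.
Qed.

End AssociatorCocycle.

(** * The skeletal permutative groupoid of a bilinear form *)

Section SkeletalModel.
Variables (A B : zmodType) (s : A -> A -> B).
Hypotheses (s_bilin : forall a b c, s a (b + c) = s a b + s a c)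
  (s_invol : forall a b, s b a + s a b = 0).

(** An element of [B], available only when the ends agree; the endpoint equation is carried along,
    so composition needs no transport. *)
Definition skel_hom (a b : A) : Type := {u : B | a = b}.

Definition skel_mk (a b : A) (ab : a = b) (u : B) : skel_hom a b :=
  exist (fun _ => a = b) u ab.

Lemma skel_hom_eq (a b : A) (f g : skel_hom a b) : sval f = sval g -> f = g.
Proof. by case: f g => [u p] [v q] /= uv; apply: eq_exist. Qed.

Definition skel_comp (a b c : A) (g : skel_hom b c) (f : skel_hom a b) :
  skel_hom a c := skel_mk (etrans (svalP f) (svalP g)) (sval g + sval f).

Definition skel_cat : Category.
Proof.
refine {| Obj := A; Hom := skel_hom;
  idm := fun a => skel_mk (erefl a) 0; comp := skel_comp |}.
- by move=> x y f; apply: skel_hom_eq; exact: add0r.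
- by move=> x y f; apply: skel_hom_eq; exact: addr0.
- by move=> w x y z h g f; apply: skel_hom_eq; exact: addrA.
Defined.

Lemma skel_groupoid : groupoid skel_cat.
Proof.
move=> x y f; exists (skel_mk (esym (svalP f)) (- sval f) : (y : skel_cat) ~> x).
by split; apply: skel_hom_eq; [exact: addNr|exact: addrN].
Qed.

Definition skel_smc : SymMonCat.
Proof.
refine {| smc_cat := skel_cat; unit_obj := (0 : A) : skel_cat;
  tens := (fun a b : A => a + b) : skel_cat -> skel_cat -> skel_cat;
  tensm := fun x x' y y' f g =>
    skel_mk (congr2 +%R (svalP f) (svalP g)) (sval f + sval g);
  assoc := fun x y z => skel_mk (esym (addrA x y z)) 0;
  lunit := fun x => skel_mk (add0r x) 0;
  runit := fun x => skel_mk (addr0 x) 0;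
  symm := fun x y => skel_mk (addrC x y) (s x y) |};
  try (by move=> *; exact: skel_groupoid).
- by move=> x y; apply: skel_hom_eq; exact: addr0.
- by move=> x x' x'' y y' y'' f' f g' g; apply: skel_hom_eq; exact: addrACA.
- move=> x x' y y' z z' f g h; apply: skel_hom_eq.
  by rewrite /= add0r addr0 addrA.
- by move=> x x' f; apply: skel_hom_eq; rewrite /= !(add0r, addr0).
- by move=> x x' f; apply: skel_hom_eq; rewrite /= !(add0r, addr0).
- move=> x x' y y' [u p] [v q]; apply: skel_hom_eq => /=; subst.
  by rewrite addrC (addrC u).
- by move=> w x y z; apply: skel_hom_eq; rewrite /= !addr0.
- by move=> x y; apply: skel_hom_eq; rewrite /= !addr0.
- by move=> x y; apply: skel_hom_eq; exact: s_invol.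
- move=> x y z; apply: skel_hom_eq; rewrite /= s_bilin; zmod.
Defined.

Lemma skel_picard : picard skel_smc.
Proof.
split; first exact: skel_groupoid.
move=> x; exists (- (x : A)); exists (skel_mk (addNr (x : A)) 0).
exact: skel_groupoid.
Qed.

Lemma skel_skeletal : skeletal skel_smc.
Proof. by move=> x y [f _]; exact: (svalP f). Qed.

Lemma skel_identity (a b : A) (ab : a = b) :
  is_identity (skel_mk ab 0 : (a : skel_cat) ~> b).
Proof. by case: _ / ab; exact: (is_identity_idm (a : skel_cat)). Qed.

Lemma skel_permutative : permutative skel_smc.
Proof. by split; [|split] => *; exact: skel_identity. Qed.

End SkeletalModel.

(** * The equivalence with the skeletal model *)

Section Comparison.
Variables (C : SymMonCat) (pC : picard C).
Local Notation P0 := (pi0 pC).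
Local Notation P1 := (pi1 pC).
Local Notation cls := (cls pC).
Local Notation value := (value pC).
Variables (T : C -> C -> P1) (s : P0 -> P0 -> P1) (e : P1).
Hypotheses
  (T_tens : forall (x x' y y' : C) (f : x ~> x') (g : y ~> y'),
     value (f ⊕m g) = value f + value g + T x y - T x' y')
  (T_assoc : forall x y z : C,
     value (assoc x y z) = T (x ⊕ y) z + T x y - T y z - T x (y ⊕ z))
  (T_symm : forall x y : C,
     value (symm x y) = s (cls x) (cls y) + T x y - T y x)
  (T_lunit : forall x : C, value (lunit x) = e + T unit_obj x)
  (T_runit : forall x : C, value (runit x) = e + T x unit_obj)
  (s_bilin : forall a b c, s a (b + c) = s a b + s a c)
  (s_invol : forall a b, s b a + s a b = 0).
Let D := skel_smc s_bilin s_invol.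

Definition to_skel_functor : Functor C D.
Proof.
refine {| fobj := (fun x => cls x) : C -> D;
  fmap := fun x y f => skel_mk (hom_cls pC f) (value f) |}.
- by move=> x; apply: skel_hom_eq; exact: value_id.
- by move=> x y z g f; apply: skel_hom_eq; exact: value_comp.
Defined.

(** With structure maps [- T] and [- e], the coherence conditions become the hypotheses on [T]. *)
Definition to_skel : StrongSymMonFunctor C D.
Proof.
refine {| smf_functor := to_skel_functor;
  smf_mu := fun x y => skel_mk (clsD pC x y) (- T x y);
  smf_eps := skel_mk (esym (cls0 pC)) (- e) |};
  try (by move=> *; exact: skel_groupoid).
- move=> x x' y y' f g; apply: skel_hom_eq; rewrite /= T_tens; zmod.
- move=> x y z; apply: skel_hom_eq; rewrite /= T_assoc; zmod.
- move=> x; apply: skel_hom_eq; rewrite /= T_lunit; zmod.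
- move=> x; apply: skel_hom_eq; rewrite /= T_runit; zmod.
- move=> x y; apply: skel_hom_eq; rewrite /= T_symm; zmod.
Defined.

Fact ex_lift (a b : P0) (f : (a : D) ~> b) :
  exists g : rep a ~> rep b, value g = sval f.
Proof. by apply: value_surj; rewrite !repK; exact: (svalP f). Qed.

Definition lift (a b : P0) (f : (a : D) ~> b) : rep a ~> rep b :=
  sval (cid (ex_lift f)).

Lemma value_lift (a b : P0) (f : (a : D) ~> b) : value (lift f) = sval f.
Proof. exact: (svalP (cid (ex_lift f))). Qed.

Definition from_skel : Functor D C.
Proof.
refine {| fobj := (fun a : P0 => rep a) : D -> C;
  fmap := fun a b f => lift f |}.
- by move=> a; apply: (@value_inj _ pC); rewrite value_lift value_id.
- move=> a b d g f; apply: (@value_inj _ pC).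
  by rewrite value_comp !value_lift.
Defined.

Lemma to_skel_equivalence : is_equivalence to_skel.
Proof.
(* Isomorphisms of value 0 are natural, since morphisms are determined by their values. *)
have counit (x : C) : {g : rep (cls x) ~> x | value g = 0}.
  by apply: cid; apply: value_surj; rewrite repK.
exists from_skel; split.
- exists (fun x => sval (counit x)); split=> [x|x y f]; first exact: (proj1 pC).
  apply: (@value_inj _ pC); rewrite !value_comp !(svalP (counit _)) /=.
  by rewrite value_lift addr0 add0r.
- exists (fun a : D => skel_mk (repK (a : P0)) 0); split=> [a|a b f].
    exact: skel_groupoid.
  by apply: skel_hom_eq; rewrite /= value_lift addr0 add0r.
Qed.

End Comparison.

Theorem theoremB : forall C : SymMonCat, picard C ->
  exists D : SymMonCat,
    picard D /\ skeletal D /\ permutative D /\ sym_mon_equivalent C D.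
Proof.
move=> C pC.
have [T [s [e [[T_tens T_assoc T_symm T_l T_r] s_bilin s_invol]]]] :=
  exists_strict_defect pC.
exists (skel_smc s_bilin s_invol); split; first exact: skel_picard.
split; first exact: skel_skeletal.
split; first exact: skel_permutative.
exists (to_skel T_tens T_assoc T_symm T_l T_r s_bilin s_invol).
exact: to_skel_equivalence.
Qed.
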